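(* There exists a family $\mathcal{F}$ of cardinality $\mathfrak{c} = |\mathbb{R}|$ of pairwise non-homeomorphic compact metrizable zero-dimensional topological spaces such that $X \times X$ is homeomorphic to $X$ for each $X \in \mathcal{F}$. *)

(* Defs.v *)
From HB Require Import structures.
From mathcomp Require Import all_boot all_order all_algebra.
From mathcomp Require Import all_classical all_reals all_analysis.

Set Implicit Arguments.
Unset Strict Implicit.
Unset Printing Implicit Defensive.

Import Order.TTheory GRing.Theory Num.Theory.
Import numFieldNormedType.Exports.

Local Open Scope classical_set_scope.
Local Open Scope ring_scope.

Definition homeomorphic (X Y : topologicalType) : Prop :=
  exists (f : X -> Y) (g : Y -> X),
    [/\ continuous f, continuous g, cancel f g & cancel g f].

(* The axioms are those of the factory [isMetric]. *)
Definition is_metric (R : realType) (T : Type) (d : T -> T -> R) : Prop :=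
  [/\ forall x, d x x = 0,
      forall x y, d x y = 0 -> x = y,
      forall x y, d x y = d y x &
      forall y x z, d x z <= d x y + d y z].

Definition metrizable (R : realType) (X : topologicalType) : Prop :=
  exists2 d : X -> X -> R, is_metric d &
    forall x : X,
      nbhs x = nbhs_ball_ (fun (c : X) (e : R) => [set y | d c y < e]) x.

(* The usual notion of zero-dimensionality: a base of clopen sets.  The
   library's [zero_dimensional] only asks that clopen sets separate points,
   which is weaker for general topological spaces. *)
Definition has_clopen_basis (X : topologicalType) : Prop :=
  exists2 B : set (set X), B `<=` clopen & basis B.

(* Main.v *)
Require Import Defs.
From HB Require Import structures.
From mathcomp Require Import all_boot all_order all_algebra.
From mathcomp Require Import all_classical all_reals all_analysis.
From mathcomp Require Import zify.

Set Implicit Arguments.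
Unset Strict Implicit.
Unset Printing Implicit Defensive.

Import Order.TTheory GRing.Theory Num.Theory.
Import numFieldNormedType.Exports.

Local Open Scope classical_set_scope.
Local Open Scope ring_scope.

(* Let M be a compact metrizable zero-dimensional space with an isolated point
   m0.  Label the nodes of the infinite binary tree by points of M and mark a
   node when its label is not m0 or one of its children is marked; marks that
   are not forced by a label below come from the limits, so that the labellings
   with a coherent marking form a compact space W.  Splitting at the root gives
   W = M * W * W, hence X = M * W satisfies
   X * X = M * (M * W * W) = M * W = X.
   The points of X whose root is unmarked form a clopen copy of M.

   For each set A of naturals there is such an M from which A can be read off
   by means of iterated Cantor-Bendixson derivatives, even when M is only given
   as a clopen subset of a larger space.  As X has countably many clopen
   subsets, each homeomorphism class of these spaces X comes from countably
   many A only, and a Koenig-type argument extracts continuum many pairwise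
   non-homeomorphic spaces. *)

(** * Locally constant functions and clopen sets *)

Definition locally_constant (X : topologicalType) (D : Type) (g : X -> D) :=
  forall x, \forall y \near x, g y = g x.

Lemma locally_constant_cst (X : topologicalType) (D : Type) (d : D) :
  locally_constant (fun _ : X => d).
Proof. by move=> x; near=> y. Unshelve. all: end_near. Qed.

Lemma locally_constant_comp (X Y : topologicalType) (D : Type)
    (f : X -> Y) (g : Y -> D) :
  continuous f -> locally_constant g -> locally_constant (g \o f).
Proof. by move=> cf cg x; exact: (cf x _ (cg (f x))). Qed.

Lemma locally_constant1 (X : topologicalType) (D E : Type) (h : D -> E)
    (g : X -> D) :
  locally_constant g -> locally_constant (fun x => h (g x)).
Proof. by move=> cg x; apply: filterS (cg x) => y /= ->. Qed.

Lemma locally_constant2 (X : topologicalType) (D E F : Type) (h : D -> E -> F)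
    (g : X -> D) (k : X -> E) :
  locally_constant g -> locally_constant k ->
  locally_constant (fun x => h (g x) (k x)).
Proof. by move=> cg ck x; apply: filterS2 (cg x) (ck x) => y /= -> ->. Qed.

Lemma locally_constant_continuous (X Y : topologicalType) (g : X -> Y) :
  locally_constant g -> continuous g.
Proof.
by move=> cg x U Ux; apply: filterS (cg x) => y /= ->; exact: nbhs_singleton.
Qed.

Lemma locally_constant_bool (X : topologicalType) (g : X -> bool) :
  continuous g -> locally_constant g.
Proof.
by move=> cg x; apply: (cg x [set b | b = g x]); exact/principal_filterP.
Qed.

Lemma locally_constant_open (X : topologicalType) (g : X -> bool) :
  locally_constant g -> open [set x | g x].
Proof.
by move=> cg; rewrite openE => x /= gx; apply: filterS (cg x) => y /= ->.
Qed.

Lemma locally_constant_clopen (X : topologicalType) (g : X -> bool) :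
  locally_constant g -> clopen [set x | g x].
Proof.
move=> cg; split; first exact: locally_constant_open.
rewrite -[X in closed X]setCK; apply: open_closedC.
have -> : ~` [set x | g x] = [set x | ~~ g x] by apply/seteqP; split=> x /negP.
exact/locally_constant_open/locally_constant1.
Qed.

Lemma locally_constant_clopenP (X : topologicalType) (U : set X) :
  clopen U -> locally_constant (fun x => `[< U x >]).
Proof.
move=> [oU cU] x; have [Ux|nUx] := pselect (U x).
  apply: filterS (open_nbhs_nbhs (conj oU Ux)) => y Uy.
  by rewrite (asboolT Ux) (asboolT Uy).
apply: filterS (open_nbhs_nbhs (conj (closed_openC cU) nUx)) => y Uy.
by rewrite (asboolF nUx) (asboolF Uy).
Qed.

(** * Separating sequences of locally constant functions *)

Definition separating (X : topologicalType) (D : Type)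
    (phi : nat -> X -> D) :=
  (forall n, locally_constant (phi n)) /\
  forall x y, (forall n, phi n x = phi n y) -> x = y.

(** The [phi n] are the coordinates of an embedding into the Cantor set, so these are the compact
    metrizable zero-dimensional spaces in a form stable under products. *)
Definition cantor_compact (X : topologicalType) :=
  compact [set: X] /\ exists phi : nat -> X -> bool, separating phi.

Lemma separating_count (X : topologicalType) (I : countType)
    (phi : I -> X -> bool) :
  (forall i, locally_constant (phi i)) ->
  (forall x y, (forall i, phi i x = phi i y) -> x = y) ->
  exists psi : nat -> X -> bool, separating psi.
Proof.
move=> cphi phiI.
exists (fun n x => if unpickle n is Some i then phi i x else false); split.
  by move=> n; case: unpickle => [i|]; [exact: cphi|exact: locally_constant_cst].
by move=> x y E; apply: phiI => i; have := E (pickle i); rewrite pickleK.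
Qed.

Lemma cantor_compact_prod (X Y : topologicalType) :
  cantor_compact X -> cantor_compact Y -> cantor_compact (X * Y)%type.
Proof.
move=> [cX [phi [phic phiI]]] [cY [psi [psic psiI]]]; split.
  by rewrite -setXTT; exact: compact_setX.
pose chi (i : nat + nat) (z : X * Y) :=
  match i with inl n => phi n z.1 | inr n => psi n z.2 end.
apply: (@separating_count _ _ chi).
  move=> [n|n].
    by apply: (@locally_constant_comp _ X _ fst (phi n)) => // x; exact: cvg_fst.
  by apply: (@locally_constant_comp _ Y _ snd (psi n)) => // x; exact: cvg_snd.
move=> [x y] [x' y'] E; congr pair.
  by apply: phiI => n; exact: (E (inl n)).
by apply: psiI => n; exact: (E (inr n)).
Qed.

(** * Cylinders as a clopen basis *)

Section Cylinders.
Variables (X : topologicalType) (D : eqType) (phi : nat -> X -> D).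
Hypotheses (cX : compact [set: X]) (phiP : separating phi).

Definition agree n x y := all (fun k => phi k x == phi k y) (iota 0 n).

Lemma agreeP n x y :
  reflect (forall k, (k < n)%N -> phi k x = phi k y) (agree n x y).
Proof.
apply: (iffP allP) => [H k kn|H k]; first by apply/eqP/H; rewrite mem_iota.
by rewrite mem_iota => /andP[_ kn]; apply/eqP/H.
Qed.

Lemma agree_locally_constant n x : locally_constant (agree n x).
Proof.
rewrite /agree; elim: (iota 0 n) => [|k s IH] /=.
  exact: locally_constant_cst.
apply: (locally_constant2 andb) => //.
exact/(locally_constant1 (fun b => phi k x == b))/phiP.1.
Qed.

Lemma nbhs_agree n x : nbhs x [set y | agree n x y].
Proof.
apply: open_nbhs_nbhs; split; last exact/agreeP.
exact/locally_constant_open/agree_locally_constant.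
Qed.

(** Each [y] other than [x] is separated from [x] by some coordinate, constantly so near [y];
    compactness bounds the coordinates needed outside [U]. *)
Lemma nbhs_cylinder x U : nbhs x U -> exists n, [set y | agree n x y] `<=` U.
Proof.
move=> Ux; have := cX; rewrite compact_near_coveringP => /(_ nat \oo
  (fun n y => agree n x y -> U y)) [] => [y _|N _ HN]; last first.
  by exists N => y; apply: (HN N (leqnn N)).
have [<-|/eqP xy] := eqVneq x y.
  by exists (U, setT) => [|[y' n] [/= Uy' _] _] //; split=> //; exact: filterT.
have [k kP] : exists k, phi k x <> phi k y.
  by apply/existsNP => E; apply: xy; exact: phiP.2.
exists ([set y' | phi k y' = phi k y], [set n | (k < n)%N]).
  by split=> /=; [exact: phiP.1|exact: nbhs_infty_gt].
by move=> [y' n] /= [E kn] /agreeP/(_ _ kn); rewrite E.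
Qed.

Lemma cylinder_basis : has_clopen_basis X.
Proof.
exists [set [set y | agree p.1 p.2 y] | p in [set: nat * X]].
  move=> _ [[n x] _ <-]; exact/locally_constant_clopen/agree_locally_constant.
split=> [_ [[n x] _ <-]|x U /nbhs_cylinder[n nU]].
  exact/locally_constant_open/agree_locally_constant.
exists [set y | agree n x y] => //; split; last exact/agreeP.
by exists (n, x).
Qed.

(** Near each point finitely many coordinates decide membership in [U]; compactness makes their
    number uniform. *)
Lemma clopen_cylinder (U : set X) :
  clopen U -> exists n, forall x y, agree n x y -> U x -> U y.
Proof.
move=> cU; have := cX; rewrite compact_near_coveringP => /(_ nat \oo
  (fun n x => forall y, agree n x y -> U x -> U y)) [] => [x _|N _ HN].
  have [n nU] := nbhs_cylinder (locally_constant_clopenP cU x).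
  exists ([set y | agree n x y], [set m | (n <= m)%N]).
    by split=> /=; [exact: nbhs_agree|exact: nbhs_infty_ge].
  move=> [x' m] /= [xx' nm] y /agreeP x'y Ux'.
  have xy : agree n x y.
    apply/agreeP => k kn; rewrite (agreeP _ _ _ xx' k kn).
    exact/x'y/(leq_trans kn).
  by apply/asboolP; rewrite (nU _ xy) -(nU _ xx'); exact/asboolP.
by exists N => x; apply: (HN N (leqnn N)).
Qed.

(** * The first-difference ultrametric *)

Section Metric.
Variable R : realType.

Lemma separating_index x y : x <> y -> exists n, phi n x != phi n y.
Proof.
move=> xy; apply: contrapT => /forallNP E; apply: xy; apply: phiP.2 => n.
by apply/eqP/negPn/negP/E.
Qed.

Definition cylinder_dist (x y : X) : R :=
  if pselect (x = y) is right xy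
  then (ex_minn (separating_index xy)).+1%:R^-1 else 0.

Lemma cylinder_dist_lt n x y : (cylinder_dist x y < n.+1%:R^-1) = agree n.+1 x y.
Proof.
rewrite /cylinder_dist; case: pselect => [->|xy].
  by rewrite invr_gt0 ltr0n; apply/esym/agreeP.
case: ex_minnP => m mP mmin; rewrite ltf_pV2 ?posrE ?ltr0n // ltr_nat ltnS.
apply/idP/agreeP => [nm k kn|E].
  by apply/eqP; apply: contraTT (leq_trans kn nm) => /mmin; rewrite -leqNgt.
by rewrite ltnNge; apply: contra mP => mn; apply/eqP/E.
Qed.

Lemma cylinder_dist_ge0 x y : 0 <= cylinder_dist x y.
Proof. by rewrite /cylinder_dist; case: pselect. Qed.

Lemma cylinder_dist_cases x y :
  cylinder_dist x y = 0 \/ exists n, cylinder_dist x y = n.+1%:R^-1.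
Proof.
rewrite /cylinder_dist; case: pselect => [_|xy]; first by left.
by right; exists (ex_minn (separating_index xy)).
Qed.

Lemma cylinder_dist_is_metric : is_metric cylinder_dist.
Proof.
have agreeC n x y : agree n x y = agree n y x.
  by apply: eq_all => k; rewrite eq_sym.
have distC x y : cylinder_dist x y = cylinder_dist y x.
  rewrite /cylinder_dist; case: pselect => [xy|xy]; case: pselect => [yx|yx] //.
  - by case: yx.
  - by case: xy.
  case: ex_minnP => m mP mmin; case: ex_minnP => m' m'P m'min.
  congr (_.+1%:R^-1); apply/eqP; rewrite eqn_leq mmin 1?m'min // eq_sym //.
split=> [x|x y|//|y x z].
- by rewrite /cylinder_dist; case: pselect.
- rewrite /cylinder_dist; case: pselect => // xy E.
  have := invr_gt0 ((ex_minn (separating_index xy)).+1%:R : R).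
  by rewrite E ltxx ltr0n.
(* If the inequality failed, both distances through [y] would be below that of [x] and [z], and [x],
   [z] would agree beyond their first difference. *)
rewrite leNgt; apply/negP => lt.
have [E|[n E]] := cylinder_dist_cases x z.
  by move: lt; rewrite E ltNge addr_ge0 ?cylinder_dist_ge0.
have xy : cylinder_dist x y < n.+1%:R^-1.
  by rewrite -E (le_lt_trans _ lt) // lerDl cylinder_dist_ge0.
have yz : cylinder_dist y z < n.+1%:R^-1.
  by rewrite -E (le_lt_trans _ lt) // lerDr cylinder_dist_ge0.
move: xy yz; rewrite !cylinder_dist_lt => /agreeP xy /agreeP yz.
have : agree n.+1 x z by apply/agreeP => k kn; rewrite xy // yz.
by rewrite -cylinder_dist_lt E ltxx.
Qed.

Lemma cylinder_metrizable : metrizable R X.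
Proof.
exists cylinder_dist; first exact: cylinder_dist_is_metric.
move=> x; apply/seteqP; split=> U.
  move=> /nbhs_cylinder[n nU]; exists n.+1%:R^-1; first by rewrite /= invr_gt0.
  move=> y; rewrite /= cylinder_dist_lt => /agreeP xy; apply: nU => /=.
  by apply/agreeP => k kn; apply: xy; exact: ltnW.
move=> [e /= e0 eU]; have [n ne] := ltr_add_invr e0.
apply: filterS (nbhs_agree n.+1 x) => y; rewrite /= -cylinder_dist_lt => xy.
by apply: eU => /=; rewrite (lt_trans xy) // -[_^-1]add0r.
Qed.

End Metric.
End Cylinders.

(** A clopen set is determined by a length [n] and the finite list of words of length [n] read off
    its points, and such data are countable. *)
Lemma clopen_code (X : topologicalType) : cantor_compact X ->
  exists c : set X -> nat, forall U V, clopen U -> clopen V -> c U = c V -> U = V.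
Proof.
move=> [cX [phi phiP]].
pose sg n x := [seq phi k x | k <- iota 0 n].
have sgP n x y : sg n x = sg n y -> agree phi n x y.
  by move/eq_in_map => H; apply/allP => k kn; apply/eqP/H.
have /choice[c cP] (U : set X) : exists c : nat * seq (seq bool), clopen U ->
    forall x, U x <-> sg c.1 x \in c.2.
  have [cU|ncU] := pselect (clopen U); last by exists (0%N, [::]).
  have [n nU] := clopen_cylinder cX phiP cU.
  pose s := [seq val t | t <- enum {: n.-tuple bool} &
    `[< exists2 x, U x & sg n x = val t >]].
  exists (n, s) => _ x; split=> [Ux|/mapP[t]] /=.
    apply/mapP; have sz : size (sg n x) == n by rewrite size_map size_iota.
    exists (Tuple sz) => //; rewrite mem_filter mem_enum andbT.
    by apply/asboolP; exists x.
  by rewrite mem_filter => /andP[/asboolP[y Uy <-] _] /esym/sgP/nU; exact.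
exists (pickle \o c) => U V cU cV /= /(pcan_inj pickleK) E.
apply/seteqP; split=> x; first by move/(cP U cU); rewrite E => /(cP V cV).
by move/(cP V cV); rewrite -E => /(cP U cU).
Qed.

(** * Closed subspaces of products *)

Lemma compact_set_type (X : topologicalType) (A : set X) :
  compact A -> compact [set: set_type A].
Proof.
move=> cA F FF _; have FA : (set_val @ F) A.
  by apply: (@filterS _ F _ setT) filterT => x _; exact: set_valP.
have [x [Ax xF]] := cA (set_val @ F) (fmap_proper_filter _ FF) FA.
exists (SigSub (mem_set Ax)); split=> // U V FU [_ [[W oW <-] Wx WV]].
have [||y [[u Uu <-] Wy]] := xF (set_val @` U) W.
- by apply: (@filterS _ F _ U) FU => u Uu; exists u.
- exact: open_nbhs_nbhs.
by exists u; split=> //; exact: WV.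
Qed.

Lemma closed_forall (X : topologicalType) (I : Type) (g : I -> X -> bool) :
  (forall i, locally_constant (g i)) -> closed [set x | forall i, g i x].
Proof.
move=> cg; have -> : [set x | forall i, g i x] = \bigcap_i [set x | g i x].
  by apply/seteqP; split=> x H i; [move=> _; exact: H|exact: H].
by apply: closed_bigI => i _; have [] := locally_constant_clopen (cg i).
Qed.

Lemma ptws_eval_continuous (I : eqType) (T : topologicalType)
    (P : set {ptws I -> T}) (i : I) :
  continuous (fun z : set_type P => set_val z i).
Proof.
move=> z; apply: (@continuous_comp _ {ptws I -> T} _ set_val (fun f => f i)).
  exact: initial_continuous.
exact: (@proj_continuous I (fun=> T) i).
Qed.

(** * Ranked spaces and their Cantor-Bendixson derivatives *)

Local Notation letter := (nat * bool)%type.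

Section Ranked.
Local Open Scope nat_scope.
Variable A : nat -> bool.

(* A sequence [f] of the form 0, 1, ..., k followed by a nonincreasing tail has
   as Cantor-Bendixson rank the limit of [f]; all of 0, 1, 2, ... is the point
   at infinity.  The bits attach a Cantor set to the point [minn j n.+1] of
   rank [n.+1] for each [n] with [A n]. *)
Definition legal : set {ptws nat -> letter} :=
  [set f : nat -> letter | [/\ (f 0).1 = 0,
     forall k, (f k.+1).1 <= (f k).1 \/ (f k).1 = k /\ (f k.+1).1 = k.+1 &
     forall k j, (f k).2 ->
       [/\ 0 < (f k).1, A (f k).1.-1 & (f j).1 = minn j (f k).1]]].

Definition ranked : topologicalType := set_type legal.

Lemma ptws_locally_constant (k : nat) :
  locally_constant (fun f : {ptws nat -> letter} => f k).
Proof.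
move=> f; have c := @proj_continuous nat (fun=> letter) k f.
apply: (c [set y | y = f k]) => /=.
exists ([set m | m = (f k).1], [set m | m = (f k).2]); last first.
  by move=> [a b] /= [-> ->]; rewrite -surjective_pairing.
by split; exact/principal_filterP.
Qed.

(** For fixed [k] and [j] the clauses involve finitely many coordinates, so they define a clopen
    set. *)
Lemma legal_closed : closed legal.
Proof.
have lc := ptws_locally_constant.
have -> : legal = [set f : {ptws nat -> letter} | forall i : (nat * nat)%type,
    [&& (f 0).1 == 0, ((f i.1.+1).1 <= (f i.1).1) ||
       ((f i.1).1 == i.1) && ((f i.1.+1).1 == i.1.+1) &
     (f i.1).2 ==> [&& 0 < (f i.1).1, A (f i.1).1.-1 &
                       (f i.2).1 == minn i.2 (f i.1).1]]].
  apply/seteqP; split=> f.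
    move=> [f0 f1 f2] [k j] /=; rewrite f0 eqxx /=; apply/andP; split; last first.
      by apply/implyP => /f2 -/(_ j) [-> -> ->] /=.
    by have [->//|[-> ->]] := f1 k; rewrite !eqxx orbT.
  move=> H; split=> [|k|k j fk].
  - by have /and3P[/eqP] := H (0, 0).
  - by have /and3P[_ /orP[?|/andP[/eqP ? /eqP ?]] _] := H (k, 0); [left|right].
  by have /and3P[_ _ /implyP/(_ fk)/and3P[? ? /eqP ?]] := H (k, j).
apply: closed_forall => -[k j] /=.
apply: (locally_constant2 andb).
  exact: (locally_constant1 (fun u => u.1 == 0)).
apply: (locally_constant2 andb).
  exact: (locally_constant2
    (fun u v => (u.1 <= v.1) || (v.1 == k) && (u.1 == k.+1))).
exact: (locally_constant2 (fun u v => u.2 ==> [&& 0 < u.1, A u.1.-1 &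
  v.1 == minn j u.1])).
Qed.

Implicit Types z : ranked.

Definition rk z k := (set_val z k).1.
Definition bt z k := (set_val z k).2.

Lemma rk0 z : rk z 0 = 0.
Proof. by have [] := set_valP z. Qed.

Lemma rkS z k : rk z k.+1 <= rk z k \/ rk z k = k /\ rk z k.+1 = k.+1.
Proof. by have [_ + _] := set_valP z; exact. Qed.

Lemma rk_le z k : rk z k <= k.
Proof. by elim: k => [|k IH]; [rewrite rk0|case: (rkS z k) => H; lia]. Qed.

(** A sequence that has left the diagonal cannot return to it, and only on the diagonal can it
    increase. *)
Lemma rk_mono z k j : rk z k < k -> k <= j -> rk z j <= rk z k.
Proof.
move=> kk; elim: j => [|j IH]; first by case: (k) kk.
rewrite leq_eqVlt => /orP[/eqP <-//|]; rewrite ltnS => kj.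
by have := IH kj; case: (rkS z j); lia.
Qed.

Lemma rk_pred z k : k < rk z k.+1 -> rk z k = k.
Proof. by case: (rkS z k) => [|[]//]; have := rk_le z k; lia. Qed.

(** The points of the attached Cantor sets: bits at indices from [n.+1] on are free, earlier ones
    vanish. *)
Definition special z := exists2 n, A n & forall j, rk z j = minn j n.+1.

Lemma bt_special z k : bt z k -> special z.
Proof.
move=> zk; have [_ _ H] := set_valP z.
have [k0 Ak _] := H k 0 zk; exists (rk z k).-1 => // j.
by have [_ _] := H k j zk; rewrite prednK.
Qed.

Lemma ranked_eq z z' : (forall k, rk z k = rk z' k) ->
  (forall k, bt z k = bt z' k) -> z = z'.
Proof.
move=> rE bE; apply: val_inj; apply/funext => k.
have := rE k; have := bE k; rewrite /rk /bt !set_valE.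
by case: (\val z k) (\val z' k) => [? ?] [? ?] /= -> ->.
Qed.

Definition coord (k : nat) z : letter := set_val z k.

Lemma coord_separating : separating coord.
Proof.
split=> [n|z z' E].
  apply: (@locally_constant_comp _ {ptws nat -> letter} _ set_val
    (fun f => f n)); first exact: initial_continuous.
  exact: ptws_locally_constant.
by apply: ranked_eq => k; have := E k; rewrite /coord /rk /bt => ->.
Qed.

(** Since [rk z k <= k], each coordinate takes finitely many values and Tychonoff applies. *)
Lemma ranked_compact : compact [set: ranked].
Proof.
apply: compact_set_type.
apply: (@subclosed_compact _ _ [set f : {ptws nat -> letter} |
    forall k, [set u : letter | u.1 <= k] (f k)]).
- exact: legal_closed.
- apply: (@tychonoff nat (fun=> letter)
    (fun k => [set u : letter | u.1 <= k])) => k.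
  have -> : [set u : letter | u.1 <= k] = `I_k.+1 `*` setT.
    by apply/seteqP; split=> [[a b]|[a b] []] //=.
  by apply: compact_setX; [exact: finite_compact|exact: bool_compact].
move=> f fP k /=; exact: (rk_le (SigSub (mem_set fP : f \in legal)) k).
Qed.

Lemma ranked_cantor : cantor_compact ranked.
Proof.
split; first exact: ranked_compact.
have [cc cI] := coord_separating.
apply: (@separating_count _ (nat * letter)%type
  (fun i z => coord i.1 z == i.2)) => [[k u]|z z' E].
  exact: (locally_constant1 (fun v => v == u)).
by apply: cI => k; apply/esym/eqP; rewrite -(E (k, coord k z)) /= eqxx.
Qed.

Local Notation agr := (agree coord).

Lemma agrP N z z' : reflect
  (forall k, k < N -> rk z k = rk z' k /\ bt z k = bt z' k) (agr N z z').
Proof.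
apply: (iffP (agreeP _ _ _ _)) => H k /H; rewrite /coord /rk /bt.
  by move=> ->.
by case: (set_val z k) (set_val z' k) => [? ?] [? ?] /= [-> ->].
Qed.

Lemma limit_rankedP (E : set ranked) z : limit_point E z <->
  forall N, exists z', [/\ z' <> z, E z' & agr N z z'].
Proof.
split=> [zE N|H U /(nbhs_cylinder ranked_compact coord_separating)[N NU]].
  have [z' [/eqP ? ? ?]] := zE _ (nbhs_agree coord_separating N z).
  by exists z'.
by have [z' [/eqP ? ? /NU ?]] := H N; exists z'.
Qed.

Lemma closure_rankedP (E : set ranked) z : closure E z <->
  forall N, exists2 z', E z' & agr N z z'.
Proof.
split=> [zE N|H U /(nbhs_cylinder ranked_compact coord_separating)[N NU]].
  by have [z' [? ?]] := zE _ (nbhs_agree coord_separating N z); exists z'.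
by have [z' ? /NU ?] := H N; exists z'.
Qed.

(** The shape of the [n]-th derived set: special points lie in a perfect set and survive every
    derivative, the others survive up to their rank. *)
Definition rank_ge n z := special z \/ forall j, n <= j -> n <= rk z j.

(** Off the diagonal, the value at [k] fixes the whole rank sequence of any special neighbour, and
    [z] departs from that sequence at a finite index. *)
Lemma nspecial_nbhs z k : ~ special z -> rk z k < k ->
  exists N, forall z', agr N z z' -> ~ special z'.
Proof.
move=> nsz kk.
have [Ak|nAk] := pselect (0 < rk z k /\ A (rk z k).-1); last first.
  exists k.+1 => z' /agrP/(_ k (ltnSn k))[E _] [m Am mE]; apply: nAk.
  have := mE k; rewrite -E => Ek; have -> : rk z k = m.+1 by lia.
  by split.
have [j jE] : exists j, rk z j <> minn j (rk z k).
  apply/existsNP => H; apply: nsz; exists (rk z k).-1; first by case: Ak.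
  by move=> j; rewrite H; congr minn; lia.
exists (maxn k j).+1 => z' /agrP zz' [m Am mE]; apply: jE.
have [|Ej _] := zz' j; first by lia.
have [|Ek _] := zz' k; first by lia.
by rewrite Ej mE Ek mE; have := mE k; lia.
Qed.

Lemma dropped_legal z N m : m <= rk z N ->
  legal (fun j => (if j <= N then rk z j else m, false)).
Proof.
move=> mN; split=> [|k|//] /=; first by rewrite rk0.
have [kN|kN] := leqP k.+1 N; first by rewrite (ltnW kN); exact: rkS.
by left; have [kN'|//] := leqP k N; have -> : k = N by lia.
Qed.

(** Approximants of [z] of limit rank [m]: they follow its ranks up to [N] and carry no bits. *)
Definition dropped z N m (mN : m <= rk z N) : ranked :=
  SigSub (mem_set (dropped_legal mN)).

Lemma rk_dropped z N m (mN : m <= rk z N) j :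
  rk (dropped mN) j = if j <= N then rk z j else m.
Proof. by []. Qed.

Lemma dropped_nspecial z N m (mN : m <= rk z N) :
  m < rk z N -> ~ special (dropped mN).
Proof.
move=> mN' [p _ pE]; have := pE N; have := pE N.+1.
by rewrite !rk_dropped leqnn ltnn; lia.
Qed.

Lemma dropped_agr z N m (mN : m <= rk z N) :
  (forall k, bt z k = false) -> forall M, M <= N.+1 -> agr M z (dropped mN).
Proof.
move=> z0 M MN; apply/agrP => k kM; rewrite rk_dropped z0.
by have -> : k <= N by lia.
Qed.

Lemma limit_rank n : limit_point (rank_ge n) = rank_ge n.+1.
Proof.
apply/seteqP; split=> z; last first.
  move=> zn; apply/limit_rankedP => N.
  have [[m Am mE]|nsz] := pselect (special z).
    (* A special point is approached by flipping one bit, at an index beyond [N] where bits are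
       free. *)
    pose p := (maxn N m.+1).
    have fl : legal (fun j => (rk z j, bt z j (+) (j == p))).
      have [H1 H2 H3] := set_valP z; split=> // k j /=.
      have [bk _|/negbTE bk] := boolP (bt z k); first exact: H3.
      by move/eqP=> ->; rewrite !mE; split; lia ||
        (have -> : minn p m.+1 = m.+1 by lia).
    pose z' : ranked := SigSub (mem_set fl).
    exists z'; split.
    - move=> /(congr1 (fun y : ranked => bt y p)); rewrite /bt /= eqxx.
      by rewrite -/(bt z p); case: (bt z p).
    - by left; exists m.
    apply/agrP => k kN; split=> //; rewrite [RHS]/bt /= -/(bt z k).
    by have -> : k == p = false by [lia]; rewrite addbF.
  (* Otherwise [z] has rank above [n] and is approached by dropping it to [n] at late indices. *)
  case: zn => // zn; pose K := maxn N n.+1.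
  have nK : n < rk z K by apply: zn; lia.
  exists (dropped (ltnW nK)); split.
  - move=> /(congr1 (fun y : ranked => rk y K.+1)); rewrite rk_dropped ltnn.
    by have := zn K.+1; lia.
  - right=> j nj; rewrite rk_dropped; case: ifP => // _.
    have [->|nj'] := eqVneq j n; last by apply/ltnW/zn; lia.
    by rewrite (rk_pred (zn _ (leqnn _))).
  apply: dropped_agr; last by lia.
  by move=> k; apply/negP => /bt_special.
(* Conversely, a nonspecial [z] with [rk z j0 <= n] for some [j0 > n] is isolated in [rank_ge n]. *)
move=> /limit_rankedP zn; apply: contrapT => /not_orP[nsz].
move=> /existsNP[j0 /not_implyP[nj0 /negP]]; rewrite -ltnNge ltnS => j0n.
have [N Nsp] := nspecial_nbhs nsz (leq_ltn_trans j0n nj0).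
(* If [z] itself falls below [n] at some [j], agreement up to [j] already excludes every nonspecial
   [z']. *)
have [M MP] : exists M, forall z', rank_ge n z' -> ~ special z' -> agr M z z' ->
    forall j, n <= j -> n <= rk z j.
  have [H|/existsNP[j /not_implyP[nj jn]]] :=
    pselect (forall j, n <= j -> n <= rk z j); first by exists 0.
  exists j.+1 => z' [//|z'n] _ /agrP/(_ j (ltnSn j))[E _].
  by exfalso; apply: jn; rewrite E; exact: z'n.
have [z' [z'z z'n /agrP zz']] := zn (N + M + j0.+1).
have sub P : P <= N + M + j0.+1 -> agr P z z'.
  by move=> PN; apply/agrP => k kP; apply: zz'; lia.
have nsz' : ~ special z' by apply: Nsp; apply: sub; lia.
have zM : forall j, n <= j -> n <= rk z j.
  by apply: (MP z') => //; apply: sub; lia.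
(* From [j0] on, both sequences are squeezed to the constant [n], so the two points coincide. *)
case: z'n => // z'n; apply: z'z; apply: ranked_eq => k.
  have [kj0|j0k] := ltnP k j0; first by have [|-> _] := zz' k; lia.
  have [|E0 _] := zz' j0; first by lia.
  have := @rk_mono z j0 k; have := @rk_mono z' j0 k.
  by have := zM k; have := z'n k; lia.
have [/bt_special//|_] := boolP (bt z k).
by apply/negbTE/negP => /bt_special.
Qed.

Lemma iter_limit_rank n : iter n limit_point [set: ranked] = rank_ge n.
Proof.
elim: n => [|n IH] /=; last by rewrite IH limit_rank.
by apply/seteqP; split=> z // _; right.
Qed.

End Ranked.

(* In a ranked space the [n.+1]-st derived set is perfect near [z], although
   [z] is a limit of points of rank exactly [n]: this happens only at the
   attached Cantor sets. *)
Definition signature (X : topologicalType) (U : set X) : set nat :=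
  let D n := iter n limit_point U in
  [set n | exists z, [/\ D n.+2 z, closure (D n `\` D n.+1) z &
                         ~ closure (D n.+1 `\` D n.+2) z]].

(** * The signature of a ranked space *)

Section Ranked.
Local Open Scope nat_scope.
Variable A : nat -> bool.
Implicit Types z : ranked A.

Lemma top_legal n : legal A (fun j => (minn j n, false)).
Proof. by split=> [|k|k j] //=; lia. Qed.

Definition top n : ranked A := SigSub (mem_set (top_legal n)).

Lemma rk_top n j : rk (top n) j = minn j n.
Proof. by []. Qed.

Lemma bt_top n j : bt (top n) j = false.
Proof. by []. Qed.

Lemma rank_ge_dropped z N n (nN : n <= rk z N) :
  (forall j, n < j -> n < rk z j) -> n < N ->
  (rank_ge n `\` rank_ge n.+1) (dropped nN).
Proof.
move=> zn ltnN; split.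
  right=> j nj; rewrite rk_dropped; case: ifP => // _.
  have [->|nj'] := eqVneq j n; last by apply/ltnW/zn; lia.
  by rewrite (rk_pred (zn _ (leqnn _))).
have nN' := zn _ ltnN.
case=> [/dropped_nspecial-/(_ nN')//|/(_ N.+1)]; rewrite rk_dropped ltnn.
by lia.
Qed.

(** Dropping [z] to [n] at ever later indices gives points of rank exactly [n] converging to it. *)
Lemma rank_eq_closure n z :
  (forall k, bt z k = false) -> (forall j, n < j -> n < rk z j) ->
  closure (rank_ge n `\` rank_ge n.+1) z.
Proof.
move=> z0 zn; apply/closure_rankedP => N; pose K := maxn N n.+1.
have nK : n <= rk z K by apply/ltnW/zn; lia.
exists (dropped nK); first by apply: rank_ge_dropped => //; lia.
by apply: dropped_agr => //; lia.
Qed.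

Lemma signature_ranked : signature [set: ranked A] = [set n | A n].
Proof.
rewrite /signature; apply/seteqP; split=> n /=.
  move=> [z []]; rewrite -!iterS !iter_limit_rank => zn zcl znc.
  (* A bit of [z] would be shared by nearby points, making them special. *)
  have z0 k : bt z k = false.
    apply/negP => zk.
    have [z' [_ nz'] /agrP zz'] := (closure_rankedP _ _).1 zcl k.+1.
    apply: nz'; left; apply: (@bt_special _ _ k).
    by have [|_ <-] := zz' k.
  have nge : ~ forall j, n.+1 < j -> n.+1 < rk z j.
    by move=> H; apply: znc; exact: rank_eq_closure.
  case: zn => // -[m Am mE].
  (* Here [z] is special of rank [m.+1]. If [m > n], it would be a limit of points of rank exactly
     [n.+1]. *)
  have mn : m <= n.
    rewrite leqNgt; apply/negP => nm; apply: nge => j nj; rewrite mE; lia.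
  have [z' [z'n nz'] /agrP zz'] := (closure_rankedP _ _).1 zcl m.+3.
  have [|E2 _] := zz' m.+2; first by lia.
  have lt j : m.+2 <= j -> rk z' j <= m.+1.
    by move=> mj; have := @rk_mono _ z' m.+2 j; rewrite -E2 mE; lia.
  case: z'n => [sz'|z'n]; first by case: nz'; left.
  (* A nearby [z'] of rank exactly [n] ends at most at [m.+1]; if [m.+1 = n], its ranks are those of
     [z] and it is special, a contradiction. *)
  have mn' : m.+1 = n \/ m = n.
    by have := lt (maxn n m.+2); have := z'n (maxn n m.+2); lia.
  case: mn' => [mn'|<- //]; case: nz'; left; exists m => // j.
  have [jm|mj] := ltnP j m.+3; first by have [|<- _] := zz' j.
  by have := lt j; have := z'n j; lia.
move=> An; exists (top n.+1); rewrite -!iterS !iter_limit_rank; split.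
- by left; exists n.
- by apply: rank_eq_closure => [//|j nj]; rewrite rk_top; lia.
(* Near [top n.+1], a point of rank at least [n.+1] is squeezed to [minn j n.+1], hence special. *)
move=> /closure_rankedP/(_ n.+3)[z' [z'n nz'] /agrP zz'].
case: z'n => [sz'|z'n]; first by case: nz'; left.
apply: nz'; left; exists n => // j.
have [jn|nj] := ltnP j n.+3; first by have [|<- _] := zz' j.
have [|E _] := zz' n.+2; first by [].
have := @rk_mono _ z' n.+2 j; have := z'n j; rewrite -E rk_top; lia.
Qed.

End Ranked.

(** * Invariance of the signature under closed embeddings *)

Section ClosedEmbedding.
Variables (X Y : topologicalType) (f : X -> Y) (g : Y -> X).
Hypotheses (cf : continuous f) (cg : continuous g) (fK : cancel f g).
Hypothesis (clf : closed (range f)).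

Let f_inj : injective f := can_inj fK.

(** Closedness of the range keeps adherent points inside it, and [g] carries neighbourhoods over. *)
Lemma image_closure (E : set X) : closure (f @` E) = f @` closure E.
Proof.
apply/seteqP; split=> [y yE|_ [x xE <-] U /cf/xE[x' [Ex' Ux']]]; last first.
  by exists (f x'); split=> //; exists x'.
have [x _ xy] : range f y.
  by apply: clf; apply: closureS yE => _ [x _ <-]; exists x.
exists x => // U Ux; have [_ [[x' Ex' <-]]] : f @` E `&` (g @^-1` U) !=set0.
  by apply: yE; rewrite -xy; apply: cg; rewrite /= fK.
by rewrite /= fK; exists x'.
Qed.

Lemma image_limit_point (E : set X) :
  limit_point (f @` E) = f @` limit_point E.
Proof.
apply/seteqP; split=> [y yE|_ [x xE <-] U /cf/xE[x' [xx' Ex' Ux']]]; last first.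
  by exists (f x'); split; [rewrite (inj_eq f_inj)|exists x'|].
have [x _ xy] : range f y.
  by apply: clf; apply: closureS (subset_limit_point yE) => _ [x _ <-]; exists x.
exists x => // U Ux; have [y' [yy' [x' Ex' x'y'] Uy']] : exists y',
    [/\ y' != y, (f @` E) y' & (g @^-1` U) y'].
  by apply: yE; rewrite -xy; apply: cg; rewrite /= fK.
exists x'; split=> //; last by rewrite -(fK x') x'y'.
by apply: contra_neq yy' => x'x; rewrite -x'y' x'x xy.
Qed.

Lemma image_setD_inj (E F : set X) : f @` E `\` f @` F = f @` (E `\` F).
Proof.
apply/seteqP; split=> [_ [[x Ex <-] nF]|_ [x [Ex nF] <-]].
  by exists x => //; split=> // Fx; apply: nF; exists x.
by split; [exists x|move=> [x' Fx' /f_inj E']; apply: nF; rewrite -E'].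
Qed.

Lemma signature_image (U : set X) : signature (f @` U) = signature U.
Proof.
have itE n : iter n limit_point (f @` U) = f @` iter n limit_point U.
  by elim: n => //= n ->; exact: image_limit_point.
rewrite /signature; apply/seteqP; split=> n /=; rewrite -!iterS !itE.
  move=> [_ [[z zn <-] zcl ncl]]; move: zcl ncl.
  rewrite !image_setD_inj !image_closure.
  move=> -[z' z'c /f_inj E] nc; exists z; split=> //; first by rewrite -E.
move=> [z [zn zc nc]]; exists (f z); rewrite !image_setD_inj !image_closure.
split; [by exists z|by exists z|].
by move=> [z' z'c /f_inj E]; apply: nc; rewrite -E.
Qed.

End ClosedEmbedding.

(** * Continuity into products *)

Lemma ptws_continuous (I : eqType) (Y T : topologicalType)
    (f : Y -> {ptws I -> T}) :
  (forall i, continuous (fun y => f y i)) -> continuous f.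
Proof.
move=> cf y; apply/cvg_sup => i U [_ [[B oB <-] Bfy BU]].
by apply: (filterS BU); apply: (cf i y); apply: open_nbhs_nbhs.
Qed.

Lemma continuous_pair (X Y Z : topologicalType) (f : X -> Y) (g : X -> Z) :
  continuous f -> continuous g -> continuous (fun x => (f x, g x)).
Proof. by move=> cf cg x; apply: cvg_pair; [exact: cf|exact: cg]. Qed.

Lemma continuous_fst (X Y : topologicalType) : continuous (@fst X Y).
Proof. by move=> x; exact: cvg_fst. Qed.

Lemma continuous_snd (X Y : topologicalType) : continuous (@snd X Y).
Proof. by move=> x; exact: cvg_snd. Qed.

Lemma continuous_compT (X Y Z : topologicalType) (f : X -> Y) (g : Y -> Z) :
  continuous f -> continuous g -> continuous (g \o f).
Proof. by move=> cf cg x; apply: continuous_comp; [exact: cf|exact: cg]. Qed.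

(** * Marked labellings of the binary tree *)

Section Configurations.
Variables (M : topologicalType) (b : M -> bool) (m0 : M).
Hypotheses (M_cantor : cantor_compact M) (b_lc : locally_constant b).
(** [b] is a locally constant test for labels other than [m0], so [m0] is isolated. *)
Hypothesis b0 : forall m, ~~ b m <-> m = m0.

Let node := (M * bool)%type.

Definition coherent : set {ptws seq bool -> node} :=
  [set w : seq bool -> node | forall s,
    (w s).2 = [|| b (w s).1, (w (rcons s false)).2 | (w (rcons s true)).2]].

Definition config : topologicalType := set_type coherent.

Lemma config_continuous (Y : topologicalType) (f : Y -> config) :
  (forall s, continuous (fun y => set_val (f y) s)) -> continuous f.
Proof.
move=> cf; apply: continuous_comp_initial.
exact: (@ptws_continuous _ Y node (set_val \o f)).
Qed.

Lemma node_continuous s : continuous (fun w : config => set_val w s).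
Proof. exact: (@ptws_eval_continuous (seq bool) node coherent s). Qed.

Lemma support_locally_constant s :
  locally_constant (fun w : {ptws seq bool -> node} => (w s).2).
Proof.
apply: locally_constant_bool => w; apply: continuous_comp; last exact: cvg_snd.
exact: (@proj_continuous (seq bool) (fun=> node) s).
Qed.

Lemma coherent_closed : closed coherent.
Proof.
have -> : coherent = [set w : {ptws seq bool -> node} | forall s,
    (w s).2 == [|| b (w s).1, (w (rcons s false)).2 | (w (rcons s true)).2]].
  by apply/seteqP; split=> w H s; apply/eqP; exact: H.
apply: closed_forall => s; have lc := support_locally_constant.
apply: (locally_constant2 eq_op) => //; apply: (locally_constant2 orb).
  apply: (@locally_constant_comp {ptws seq bool -> node} M _
    (fun w => (w s).1) b) => // w.
  apply: continuous_comp; last exact: cvg_fst.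
  exact: (@proj_continuous (seq bool) (fun=> node) s).
exact: (locally_constant2 orb).
Qed.

Lemma config_cantor : cantor_compact config.
Proof.
have [cM [phi [phic phiI]]] := M_cantor; split.
  apply: compact_set_type.
  apply: (@subclosed_compact _ _ [set w : {ptws seq bool -> node} |
    forall s, [set: node] (w s)]) => //; first exact: coherent_closed.
  apply: (@tychonoff _ (fun=> node) (fun=> [set: node])) => _.
  by rewrite -setXTT; apply: compact_setX => //; exact: bool_compact.
(* At each node, [Some n] reads coordinate [n] of the label and [None] reads the mark. *)
pose psi (i : seq bool * option nat) (w : config) :=
  if i.2 is Some n then phi n (set_val w i.1).1 else (set_val w i.1).2.
apply: (@separating_count _ _ psi) => [[s [n|]]|w w' E].
- apply: (@locally_constant_comp _ M _ (fun w : config => (set_val w s).1)) => //.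
  move=> w; apply: (continuous_comp (@node_continuous s w)); exact: cvg_fst.
- apply: locally_constant_bool.
  move=> w; apply: (continuous_comp (@node_continuous s w)); exact: cvg_snd.
apply: val_inj; apply/funext => s; rewrite -set_valE.
rewrite [LHS]surjective_pairing [RHS]surjective_pairing; congr pair.
  by apply: phiI => n; exact: (E (s, Some n)).
exact: (E (s, None)).
Qed.

Lemma coherentE (w : config) s : (set_val w s).2 =
  [|| b (set_val w s).1, (set_val w (rcons s false)).2 |
      (set_val w (rcons s true)).2].
Proof. exact: (set_valP w s). Qed.

Lemma subconfig_coherent (c : bool) (w : config) :
  coherent (fun s => set_val w (c :: s)).
Proof. by move=> s /=; rewrite coherentE. Qed.

Definition subconfig c w : config := SigSub (mem_set (subconfig_coherent c w)).

Definition joined m (w0 w1 : config) (s : seq bool) : node :=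
  match s with
  | [::] => (m, [|| b m, (set_val w0 [::]).2 | (set_val w1 [::]).2])
  | c :: s' => set_val (if c then w1 else w0) s'
  end.

Lemma joined_coherent m w0 w1 : coherent (joined m w0 w1).
Proof. by case=> [//|c s] /=; rewrite coherentE. Qed.

Definition join m w0 w1 : config := SigSub (mem_set (joined_coherent m w0 w1)).

Lemma joinK w : join (set_val w [::]).1 (subconfig false w) (subconfig true w) = w.
Proof.
apply: val_inj; apply/funext => -[|[] s] //=; rewrite -!set_valE /=.
by rewrite [RHS]surjective_pairing (coherentE w [::]).
Qed.

Lemma subconfig_join c m w0 w1 :
  subconfig c (join m w0 w1) = if c then w1 else w0.
Proof. exact: val_inj. Qed.

Definition square_root : topologicalType := (M * config)%type.

Lemma square_root_homeomorphic :
  homeomorphic (square_root * square_root)%type square_root.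
Proof.
(* The first factor keeps its point of [M]; that of the second becomes the root label above both
   configurations. *)
exists (fun p => (p.1.1, join p.2.1 p.1.2 p.2.2)).
exists (fun p => ((p.1, subconfig false p.2),
                  ((set_val p.2 [::]).1, subconfig true p.2))).
have sub c : continuous (subconfig c).
  by apply: config_continuous => s; exact: node_continuous.
have root s : continuous (fun w : config => (set_val w s).2).
  exact: (continuous_compT (@node_continuous s) (@continuous_snd _ _)).
split=> [||[[m w] [m' w']]|[m w]] /=.
- apply: continuous_pair; first
    exact: (continuous_compT (@continuous_fst _ _) (@continuous_fst _ _)).
  apply: (@config_continuous (square_root * square_root)%type
    (fun p => join p.2.1 p.1.2 p.2.2)) => -[|[] s] /=.
  + apply: continuous_pair; first exact: (continuous_compT (@continuous_snd _ _)
      (@continuous_fst _ _)).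
    apply: locally_constant_continuous; apply: (locally_constant2 orb).
      apply: (@locally_constant_comp _ M _ (fun q => q.2.1) b) => //.
      exact: (continuous_compT (@continuous_snd _ _)
      (@continuous_fst _ _)).
    apply: (locally_constant2 orb); apply: locally_constant_bool.
      exact: (continuous_compT
      (continuous_compT (@continuous_fst _ _) (@continuous_snd _ _)) (root [::])).
    exact: (continuous_compT
      (continuous_compT (@continuous_snd _ _) (@continuous_snd _ _)) (root [::])).
  + exact: (continuous_compT
      (continuous_compT (@continuous_snd _ _) (@continuous_snd _ _)) (@node_continuous s)).
  + exact: (continuous_compT
      (continuous_compT (@continuous_fst _ _) (@continuous_snd _ _)) (@node_continuous s)).
- apply: continuous_pair.
    by apply: continuous_pair; [exact: continuous_fst|
      exact: (continuous_compT (@continuous_snd _ _) (sub false))].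
  apply: continuous_pair; last
    exact: (continuous_compT (@continuous_snd _ _) (sub true)).
  apply: (@continuous_compT square_root config M snd
    (fun w => (set_val w [::]).1)); first exact: continuous_snd.
  exact: (continuous_compT (@node_continuous [::]) (@continuous_fst _ _)).
- by rewrite !subconfig_join.
- by rewrite joinK.
Qed.

Lemma empty_coherent : coherent (fun=> (m0, false)).
Proof. by move=> s /=; rewrite orbF; apply/esym/negbTE/b0. Qed.

Definition empty_config : config := SigSub (mem_set empty_coherent).

(** Absence of a mark propagates from a node to its children, and an unmarked node has label
    [m0]. *)
Lemma empty_configP (w : config) : ~~ (set_val w [::]).2 -> w = empty_config.
Proof.
move=> w0; have wF s : (set_val w s).2 = false.
  elim/last_ind: s => [|s c IH]; first exact/negbTE.
  by move: IH; rewrite coherentE => /norP[_ /norP[/negbTE ? /negbTE ?]]; case: c.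
apply: val_inj; apply/funext => s; rewrite -set_valE [LHS]surjective_pairing wF.
congr pair; apply/b0; move: (wF s); rewrite coherentE.
by move/negbT => /norP[].
Qed.

Lemma base_embedding : exists (f : M -> square_root) (g : square_root -> M),
  [/\ continuous f, continuous g, cancel f g & clopen (range f)].
Proof.
exists (fun m => (m, empty_config)), fst; split=> //.
- by apply: continuous_pair; [move=> m; exact: cvg_id|exact: cst_continuous].
- by move=> p; exact: cvg_fst.
have -> : range (fun m => (m, empty_config)) =
    [set p : square_root | ~~ (set_val p.2 [::]).2].
  apply/seteqP; split=> [_ [m _ <-] //|[m w] /= /empty_configP ->].
  by exists m.
apply: locally_constant_clopen; apply: (locally_constant1 negb).
apply: locally_constant_bool => p.
apply: (@continuous_comp square_root config bool snd
  (fun w : config => (set_val w [::]).2)); first exact: cvg_snd.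
by apply: (continuous_comp (@node_continuous [::] p.2)); exact: cvg_snd.
Qed.

End Configurations.

(** * Recovering [A] and counting homeomorphism classes *)

Lemma rk1_locally_constant A :
  locally_constant (fun z : ranked A => rk z 1 != 0%N).
Proof.
have [lc _] := coord_separating A.
exact: (locally_constant1 (fun u => u.1 != 0%N) (lc 1%N)).
Qed.

(** A sequence with value 0 at index 1 stays at 0, and it carries no bits because special points
    have value 1 there. *)
Lemma rk1_eq0 A (z : ranked A) : ~~ (rk z 1 != 0%N) <-> z = top A 0.
Proof.
split=> [/negPn/eqP z1|->]; last by [].
have zk k : rk z k = 0%N.
  by case: k => [|k]; [exact: rk0|have := @rk_mono _ z 1 k.+1; lia].
apply: ranked_eq => k; first by rewrite zk rk_top; lia.
by rewrite bt_top; apply/negbTE/negP => /bt_special[m _ /(_ 1%N)]; lia.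
Qed.

Definition ranked_square_root (A : nat -> bool) : topologicalType :=
  square_root (fun z : ranked A => rk z 1 != 0%N).

Lemma ranked_square_root_cantor A : cantor_compact (ranked_square_root A).
Proof.
apply: cantor_compact_prod; first exact: ranked_cantor.
apply: config_cantor; first exact: ranked_cantor.
exact: rk1_locally_constant.
Qed.

Lemma homeomorphic_sym (X Y : topologicalType) :
  homeomorphic X Y -> homeomorphic Y X.
Proof. by move=> [f [g [cf cg fK gK]]]; exists g, f. Qed.

Lemma homeomorphic_trans (X Y Z : topologicalType) :
  homeomorphic X Y -> homeomorphic Y Z -> homeomorphic X Z.
Proof.
move=> [f [g [cf cg fK gK]]] [h [k [ch ck hK kK]]].
exists (h \o f), (g \o k); split.
- exact: continuous_compT cf ch.
- exact: continuous_compT ck cg.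
- exact: can_comp hK fK.
- exact: can_comp gK kK.
Qed.

Lemma signature_clopen A (X : topologicalType) :
  homeomorphic (ranked_square_root A) X ->
  exists U : set X, clopen U /\ signature U = [set n | A n].
Proof.
move=> [h [k [ch ck hK kK]]].
have [f [g [cf cg fK rf]]] := base_embedding (@rk1_eq0 A).
have rE : range (h \o f) = k @^-1` range f.
  apply/seteqP; split=> [_ [x _ <-]|y [x _ xy]]; first by exists x; rewrite //= hK.
  by exists x; rewrite //= xy kK.
have cr : clopen (range (h \o f)) by rewrite rE; exact: preimage_clopen.
exists (range (h \o f)); split=> //; rewrite -signature_ranked.
apply: (signature_image (g := g \o k)); last by case: cr.
- exact: continuous_compT cf ch.
- exact: continuous_compT ck cg.
- exact: can_comp hK fK.
Qed.

(** Each [A] in the class is the signature of some clopen subset of the fixed space, and clopen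
    subsets have injective codes. *)
Lemma homeomorphism_class_code A0 : exists c : (nat -> bool) -> nat, forall A B,
  homeomorphic (ranked_square_root A) (ranked_square_root A0) ->
  homeomorphic (ranked_square_root B) (ranked_square_root A0) ->
  c A = c B -> A = B.
Proof.
have [c cI] := clopen_code (ranked_square_root_cantor A0).
have /choice[U UP] A : exists U : set (ranked_square_root A0),
    homeomorphic (ranked_square_root A) (ranked_square_root A0) ->
    clopen U /\ signature U = [set n | A n].
  have [/signature_clopen[U UP]|nA] := pselect (homeomorphic
    (ranked_square_root A) (ranked_square_root A0)); first by exists U.
  by exists set0.
exists (c \o U) => A B /UP[cA sA] /UP[cB sB] /= /cI E.
apply/funext => n; have : [set n | A n] n = [set n | B n] n.
  by rewrite -sA -sB E.
by move=> /= AB; apply/idP/idP; rewrite AB.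
Qed.

(* König's theorem: if [2^nat = (2^nat)^nat] is covered by countably many
   pieces, one of them projects onto the factor of its own index. *)
Lemma countable_classes_transversal (E : (nat -> bool) -> (nat -> bool) -> Prop) :
  (forall A, E A A) -> (forall A B, E A B -> E B A) ->
  (forall A B C, E A B -> E B C -> E A C) ->
  (forall A0, exists c : (nat -> bool) -> nat, forall A B,
     E A A0 -> E B A0 -> c A = c B -> A = B) ->
  exists h : (nat -> bool) -> (nat -> bool), forall x y, E (h x) (h y) -> x = y.
Proof.
move=> Er Es Et /choice[c cP].
pose rep A := xget (fun=> false) [set B | E A B].
have repE A : E A (rep A).
  by apply: (@xgetPex _ (fun=> false) [set B | E A B]); exists A.
have repP A B : E A B -> rep A = rep B.
  move=> AB; congr (xget _ _); apply/seteqP; split=> C /=.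
    exact/Et/Es.
  exact: Et.
(* [code] numbers the members of each class injectively, relative to its chosen representative. *)
pose code A := c (rep A) A.
pose slice (n : nat) (A : nat -> bool) (i : nat) := A (pickle (n, i)).
have [n nP] : exists n, forall y, exists A, code A = n /\ slice n A = y.
  apply: contrapT => /forallNP H.
  have /choice[y yP] n : exists y, forall A, code A = n -> slice n A <> y.
    have /existsNP[y yP] := H n; exists y => A An sA; apply: yP.
    by exists A.
  (* Diagonal set: its slice at every [n], in particular at its own code, is the forbidden [y n]. *)
  pose A m := if unpickle m is Some (n, i) then y n i else false.
  apply: (yP (code A) A) => //; apply/funext => i.
  by rewrite /slice /A pickleK.
have [h hP] := choice nP; exists h => x y hxy.
have [cx <-] := hP x; have [cy <-] := hP y.
congr slice; apply: (cP (rep (h x))); first exact: repE.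
  by rewrite (repP _ _ hxy); exact: repE.
by move: cx cy; rewrite /code => ->; rewrite (repP _ _ hxy) => ->.
Qed.

(** A real is determined by the set of rationals below it. *)
Lemma real_to_cantor_inj (R : realType) :
  exists f : R -> nat -> bool, injective f.
Proof.
exists (fun r n => if unpickle n is Some q then ratr (q : rat) < r else false).
have lt (x y : R) : (forall q : rat, (ratr q < x) = (ratr q < y)) -> ~ x < y.
  move=> E /rat_in_itvoo[q]; rewrite in_itv /= => /andP[xq qy].
  by move: qy; rewrite -E ltNge (ltW xq).
move=> x y E; have {}E (q : rat) : (ratr q < x) = (ratr q < y).
  by have := congr1 (fun f => f (pickle q)) E; rewrite /= pickleK.
apply/eqP; rewrite eq_le !leNgt; apply/andP; split; apply/negP; apply: lt => //.
Qed.

(* The family is indexed by R itself: since distinct indices give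
   non-homeomorphic spaces, it consists of exactly |R| spaces.  A family given
   as a [set topologicalType] is ruled out by the universe constraints of the
   library. *)
Theorem theorem1p1 (R : realType) :
  exists F : R -> topologicalType,
    [/\ forall i : R,
          [/\ compact [set: F i], metrizable R (F i) & has_clopen_basis (F i)],
        forall i j : R, i <> j -> ~ homeomorphic (F i) (F j) &
        forall i : R, homeomorphic (F i * F i)%type (F i)].
Proof.
have [f f_inj] := real_to_cantor_inj R.
have [||||h hP] := @countable_classes_transversal (fun A B => homeomorphic
  (ranked_square_root A) (ranked_square_root B)).
- by move=> A; exists id, id; split=> // x; exact: cvg_id.
- by move=> A B; exact: homeomorphic_sym.
- by move=> A B C; exact: homeomorphic_trans.
- exact: homeomorphism_class_code.
exists (fun i => ranked_square_root (h (f i))); split=> [i|i j ij|i].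
- have [cX [phi phiP]] := ranked_square_root_cantor (h (f i)); split=> //.
    exact: (cylinder_metrizable cX phiP).
  exact: (cylinder_basis cX phiP).
- by move=> /hP/f_inj.
- exact/square_root_homeomorphic/rk1_locally_constant.
Qed.
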